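(* Formulation F6 is strictly tighter than Formulation F2 (both defined in the context). Explicitly, writing $X(S)_{t,m}=\sum_{t'=t-W_m+1}^{t}S_{t',m}$ for $t\in T$, $m\in M$: (i) for every instance $(T,M,(W_m)_{m\in M})$ and every continuous solution $S$ of F6, $X(S)$ is a continuous solution of F2; and (ii) there exist an instance and a continuous solution $X$ of F2 for that instance such that there is no continuous solution $S$ of F6 with $X(S)=X$.
   Context: An instance of the generator maintenance scheduling problem consists of a horizon $T=\{1,2,\dots,|T|\}$ of periods, a finite nonempty set $M$ of maintenances, and a positive integer duration $W_m$ for each $m\in M$. The variables are $X_{t,m}$ (maintenance $m$ is executed in period $t$) and $S_{t,m}$ (maintenance $m$ starts in period $t$), for $t\in T$, $m\in M$. Conventions: $X_{t,m}=0$ whenever $t\le 0$ or $t>|T|$; $S_{t,m}=0$ whenever $t\le 0$, $t>|T|$, or $t\ge |T|-W_m+2$ (a maintenance cannot start so late that it would not finish within the horizon). In particular every solution involving $S$ is required to satisfy $S_{t,m}=0$ for $t\in T$ with $t\ge |T|-W_m+2$. Formulation F2 (variables $X$ only): $\sum_{t\in T}X_{t,m}=W_m$ for all $m\in M$; $X_{t,m}-X_{t-1,m}\le X_{l,m}$ for all $t\in T$, $m\in M$, $l\in\{t,\dots,t+W_m-1\}$; $X_{t,m}\in\{0,1\}$ for all $t\in T$, $m\in M$. Formulation F6 (variables $S$ only): $\sum_{t\in T}S_{t,m}=1$ for all $m\in M$; $S_{t,m}\in\{0,1\}$ for all $t\in T$, $m\in M$. In F6 the execution variable is not explicit: the expression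 $\sum_{t'=t-W_m+1}^{t}S_{t',m}$ is used wherever $X_{t,m}$ would appear. A continuous solution of a formulation is a real assignment of its variables satisfying its linear relaxation, i.e. all its constraints with each condition ''$\in\{0,1\}$'' replaced by ''$\in[0,1]$''. A formulation A is at least as tight as B if all continuous solutions satisfying A also satisfy B; A is strictly tighter than B if A is at least as tight as B and there is at least one continuous solution satisfying B that does not satisfy A. The comparison is made in terms of $X$, with $X$ in F6 given by the expression above. *)

(* Defs.v *)
From HB Require Import structures.
From mathcomp Require Import all_boot all_order all_algebra.
From mathcomp Require Import reals.

Set Implicit Arguments.
Unset Strict Implicit.
Unset Printing Implicit Defensive.

Import Order.TTheory GRing.Theory Num.Theory.
Local Open Scope ring_scope.

Record gms_instance := GmsInstance {
  horizon : nat;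
  maint : finType;
  maint_gt0 : (0 < #|maint|)%N;
  dur : maint -> nat;
  dur_gt0 : forall m, (0 < dur m)%N
}.

(* Ordinals count from 0 while periods count from 1, hence the shift. *)
Definition period (I : gms_instance) := 'I_(horizon I).
Definition time (I : gms_instance) (t : period I) : int := (t.+1)%:Z.

Definition assignment (R : realType) (I : gms_instance) :=
  period I -> maint I -> R.

(* Value at an arbitrary integer date: the convention that variables vanish
   at dates t <= 0 and t > |T|. *)
Definition at_time (R : realType) (I : gms_instance) (X : assignment R I)
    (t : int) (m : maint I) : R :=
  if [pick i : period I | time i == t] is Some i then X i m else 0.

(* Continuous solutions of F2. *)
Definition F2_continuous (R : realType) (I : gms_instance)
    (X : assignment R I) : Prop :=
  [/\ forall m : maint I, \sum_(t : period I) X t m = (dur m)%:R,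
      forall (t : period I) (m : maint I) (l : int),
        time t <= l <= time t + (dur m)%:Z - 1 ->
        at_time X (time t) m - at_time X (time t - 1) m <= at_time X l m
    & forall (t : period I) (m : maint I), 0 <= X t m <= 1].

(* Continuous solutions of F6; the second clause is the convention that a
   maintenance cannot start too late to finish within the horizon. *)
Definition F6_continuous (R : realType) (I : gms_instance)
    (S : assignment R I) : Prop :=
  [/\ forall m : maint I, \sum_(t : period I) S t m = 1,
      forall (t : period I) (m : maint I),
        (horizon I)%:Z - (dur m)%:Z + 2 <= time t -> S t m = 0
    & forall (t : period I) (m : maint I), 0 <= S t m <= 1].

(* The sum of S_{t',m} for t' from t - W_m + 1 to t, with
   t' = t - W_m + 1 + k and 0 <= k < W_m. *)
Definition X_of_S (R : realType) (I : gms_instance) (S : assignment R I) :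
    assignment R I :=
  fun t m => \sum_(k < dur m) at_time S (time t - (dur m)%:Z + 1 + k%:Z) m.

(* Tightness is compared in terms of X: formulation A has variables of type
   V I, through which X is given by the expression [expr], and formulation B
   is stated directly on X; both are given by their continuous solutions. *)
Definition at_least_as_tight (R : realType) (V : gms_instance -> Type)
    (expr : forall I, V I -> assignment R I)
    (A : forall I, V I -> Prop) (B : forall I, assignment R I -> Prop) : Prop :=
  forall (I : gms_instance) (v : V I), A I v -> B I (expr I v).

Definition strictly_tighter (R : realType) (V : gms_instance -> Type)
    (expr : forall I, V I -> assignment R I)
    (A : forall I, V I -> Prop) (B : forall I, assignment R I -> Prop) : Prop :=
  at_least_as_tight expr A B /\
  exists (I : gms_instance) (X : assignment R I),
    B I X /\ ~ exists v : V I, A I v /\ expr I v =2 X.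

(* Main.v *)
Require Import Defs.
From HB Require Import structures.
From mathcomp Require Import all_boot all_order all_algebra.
From mathcomp Require Import reals.
From mathcomp Require Import zify ring lra.

(** A maintenance that certainly starts at date i is executed exactly at the
    dates z with i <= z < i + W.  If this window fits in the horizon, its
    indicator is a 0/1 solution of F2.  The convention on late starts kills
    S_i for every window that does not fit, so X(S) is the combination of the
    remaining indicators with weights S_i, and these weights are nonnegative
    with sum 1 (lemma [at_time_X_of_S]).  The constraints of F2 are affine, so
    they pass from the indicators to their convex combination X(S); this gives
    tightness.

    Strictness comes from one maintenance of duration 2 in three periods.  It
    can start only in period 1 or 2, so both admissible windows contain period
    2 and every X(S) satisfies X_2 = 1.  In F2 however X can be spread
    uniformly as (2/3, 2/3, 2/3): a constant X never increases after the first
    period, so the precedence constraints hold there, and a rise in period 1 is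
    only compared with X_1 and X_2. *)

Set Implicit Arguments.
Unset Strict Implicit.
Unset Printing Implicit Defensive.

Import Order.TTheory GRing.Theory Num.Theory.
Local Open Scope ring_scope.

(** * Execution windows *)

Definition in_window (I : gms_instance) (m : maint I) (i : period I) (z : int)
    : bool :=
  time i <= z < time i + (dur m)%:Z.

Lemma time_inj (I : gms_instance) : injective (@time I).
Proof. by move=> i j; rewrite /time => -[] ij; apply: val_inj. Qed.

Lemma at_time_time (R : realType) (I : gms_instance) (X : assignment R I)
    (t : period I) (m : maint I) : at_time X (time t) m = X t m.
Proof.
rewrite /at_time; case: pickP => [i /eqP/time_inj -> //|/(_ t)].
by rewrite eqxx.
Qed.

Lemma at_time_out (R : realType) (I : gms_instance) (X : assignment R I)
    (z : int) (m : maint I) :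
  (forall t : period I, time t != z) -> at_time X z m = 0.
Proof.
move=> zout; rewrite /at_time; case: pickP => [i zi|//].
by move: (zout i); rewrite zi.
Qed.

Lemma at_timeE (R : realType) (I : gms_instance) (X : assignment R I)
    (z : int) (m : maint I) :
  at_time X z m = \sum_(i : period I) X i m * (time i == z)%:R.
Proof.
rewrite /at_time; case: pickP => [i /eqP <-|out].
  rewrite (bigD1 i) //= eqxx mulr1 big1 ?addr0 // => j ji.
  by rewrite (inj_eq (@time_inj I)) (negPf ji) mulr0.
by rewrite big1 // => i _; rewrite out mulr0.
Qed.

(** The W dates z - W + 1 + k with k < W are distinct, so they meet a given
    date a at most once. *)
Lemma sum_trailing_dates (R : realType) (W : nat) (a z : int) :
  \sum_(k < W) (a == z - W%:Z + 1 + k%:Z)%R%:R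
    = (a <= z < a + W%:Z)%R%:R :> R.
Proof.
case: (boolP (a <= z < a + W%:Z)) => aw; last first.
  rewrite big1 // => k _; have := ltn_ord k.
  by case: eqP => // ak kW; exfalso; move: aw; lia.
have k0W : (absz (a - z + W%:Z - 1)%R < W)%N by lia.
rewrite (bigD1 (Ordinal k0W)) //= big1 ?addr0 => [|k kk0].
  by case: eqP => // ne; exfalso; lia.
case: eqP => // ak; exfalso; move: kk0; rewrite -val_eqE /=.
by have := ltn_ord k; lia.
Qed.

Lemma X_of_SE (R : realType) (I : gms_instance) (S : assignment R I)
    (t : period I) (m : maint I) :
  X_of_S S t m = \sum_(i : period I) S i m * (in_window m i (time t))%:R.
Proof.
rewrite /X_of_S; under eq_bigr do rewrite at_timeE.
by rewrite exchange_big /=; apply: eq_bigr => i _;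
  rewrite -mulr_sumr sum_trailing_dates.
Qed.

Lemma F6_late_start (R : realType) (I : gms_instance) (S : assignment R I)
    (i : period I) (m : maint I) :
  F6_continuous S -> (horizon I < i + dur m)%N -> S i m = 0.
Proof. by move=> [_ late _] lt; apply: late; rewrite /time; lia. Qed.

(** Outside the horizon the left-hand side vanishes by convention, whereas
    the right-hand side vanishes because no window with nonzero weight leaves
    the horizon.  Having a single formula at every date removes the boundary
    cases from the F2 constraints, which may mention dates before and after it. *)
Lemma at_time_X_of_S (R : realType) (I : gms_instance) (S : assignment R I)
    (z : int) (m : maint I) :
  F6_continuous S ->
  at_time (X_of_S S) z m =
    \sum_(i : period I) S i m * (in_window m i z)%:R.
Proof.
move=> F6S.
case: (pickP (fun t : period I => time t == z)) => [t /eqP <-|out].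
  by rewrite at_time_time X_of_SE.
rewrite at_time_out; last by move=> t; rewrite out.
rewrite big1 // => i _.
case: (boolP (in_window m i z)) => [iz|]; last by rewrite mulr0.
rewrite (F6_late_start F6S) ?mul0r //.
rewrite ltnNge; apply/negP => fits.
move: iz; rewrite /in_window /time => /andP[iz zi].
have zT : (`|z|.-1 < horizon I)%N by lia.
have := out (Ordinal zT); rewrite /time /= => /eqP; apply; lia.
Qed.

(** * Each window is a solution of F2 *)

Lemma sum_in_window (R : realType) (I : gms_instance) (m : maint I)
    (i : period I) :
  (i + dur m <= horizon I)%N ->
  \sum_(t : period I) (in_window m i (time t))%:R = (dur m)%:R :> R.
Proof.
move=> fits; rewrite -natr_sum; congr _%:R.
pose inW t : nat := (i <= t < i + dur m)%N.
rewrite (eq_bigr (fun t : period I => inW t)); last first.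
  by move=> t _; rewrite /inW /in_window /time; congr nat_of_bool; lia.
rewrite -(big_mkord xpredT inW).
have iT : (i <= horizon I)%N by lia.
(* Only the dates of the middle range i <= t < i + W contribute. *)
rewrite (big_cat_nat (n := i)) //=.
rewrite [X in (_ + X)%N](big_cat_nat (n := (i + dur m)%N)) ?leq_addr //=.
rewrite big_nat big1 ?add0n; last first.
  by move=> t tb; apply: (congr1 nat_of_bool (y := false)); lia.
rewrite [X in (_ + X)%N]big_nat [X in (_ + X)%N]big1 ?addn0; last first.
  by move=> t tb; apply: (congr1 nat_of_bool (y := false)); lia.
rewrite (eq_big_nat _ _ (F2 := fun=> 1%N)); last first.
  by move=> t tb; apply: (congr1 nat_of_bool (y := true)); lia.
by rewrite sum_nat_const_nat muln1 addKn.
Qed.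

(** An indicator of a window rises only at the first date of the window, and
    the next W - 1 dates still belong to it. *)
Lemma in_window_precedence (R : realType) (I : gms_instance) (m : maint I)
    (i t : period I) (l : int) :
  time t <= l <= time t + (dur m)%:Z - 1 ->
  (in_window m i (time t))%:R - (in_window m i (time t - 1))%:R
    <= (in_window m i l)%:R :> R.
Proof.
move=> tl; case: (boolP (in_window m i (time t))) => [it|_]; last first.
  by rewrite sub0r (le_trans (y := 0)) ?oppr_le0 ?ler0n.
case: (boolP (in_window m i (time t - 1))) => [_|it1].
  by rewrite subrr ler0n.
have -> : in_window m i l by move: tl it it1; rewrite /in_window; lia.
by rewrite subr0.
Qed.

Lemma F6_at_least_as_tight_F2 (R : realType) :
  at_least_as_tight (@X_of_S R) (@F6_continuous R) (@F2_continuous R).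
Proof.
move=> I S F6S; have [sumS _ S01] := F6S.
have S0 i m : 0 <= S i m by case/andP: (S01 i m).
split=> [m|t m l tl|t m].
- under eq_bigr do rewrite X_of_SE.
  rewrite exchange_big /= -[RHS]mul1r -[X in _ = X * _](sumS m) mulr_suml.
  apply: eq_bigr => i _; rewrite -mulr_sumr.
  have [fits|late] := leqP (i + dur m) (horizon I).
    by rewrite sum_in_window.
  by rewrite (F6_late_start F6S late) !mul0r.
- rewrite !at_time_X_of_S // -sumrB; apply: ler_sum => i _.
  by rewrite -mulrBr ler_wpM2l ?in_window_precedence.
- rewrite X_of_SE; apply/andP; split.
    by apply: sumr_ge0 => i _; rewrite mulr_ge0 ?ler0n.
  rewrite -[X in _ <= X](sumS m); apply: ler_sum => i _.
  by rewrite ler_piMr // lern1 leq_b1.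
Qed.

(** * A fractional solution of F2 that no start variables produce *)

Definition gap_instance : gms_instance :=
  @GmsInstance 3 unit (eq_leq (esym card_unit)) (fun=> 2%N) (fun=> isT).

Definition uniform_assignment (R : realType) : assignment R gap_instance :=
  fun _ _ => 2 / 3.

Lemma uniform_assignment_F2 (R : realType) :
  F2_continuous (@uniform_assignment R).
Proof.
have at_ge0 z m : 0 <= at_time (@uniform_assignment R) z m.
  rewrite /at_time; case: pickP => [i _|_] //.
  by rewrite /uniform_assignment; lra.
split=> [m|t m l tl|t m]; last by rewrite /uniform_assignment; apply/andP; split; lra.
  rewrite (eq_bigr (fun=> 2 / 3 : R)) // sumr_const card_ord /=.
  by rewrite -mulr_natr; field.
have [t0|t0] := eqVneq (t : nat) 0%N.
  (* The only rise is at the first date, where l ranges over dates 1 and 2,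
     both in the horizon. *)
  have l3 : (`|l|.-1 < 3)%N by move: t0 tl; rewrite /time /=; lia.
  have -> : l = time (Ordinal l3 : period gap_instance).
    by move: t0 tl; rewrite /time /=; lia.
  by rewrite !at_time_time lerBlDr lerDl.
have t3 : (t.-1 < 3)%N by move: t0 (ltn_ord t); rewrite /=; lia.
have -> : time t - 1 = time (Ordinal t3 : period gap_instance).
  by move: t0; rewrite /time /=; lia.
by rewrite !at_time_time subrr.
Qed.

(** Both windows that fit contain period 2, hence X_2 collects all the
    weight. *)
Lemma X_of_S_gap (R : realType) (S : assignment R gap_instance)
    (t : period gap_instance) :
  F6_continuous S -> t = 1%N :> nat -> X_of_S S t tt = 1.
Proof.
move=> F6S t1; have [sumS _ _] := F6S.
rewrite X_of_SE -[RHS](sumS tt); apply: eq_bigr => i _.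
have [i2|i2] := leqP (i + 2) 3.
  have -> : in_window (tt : maint gap_instance) i (time t).
    by move: t1 i2; rewrite /in_window /time /=; lia.
  by rewrite mulr1.
by rewrite (F6_late_start F6S) ?mul0r.
Qed.

Theorem proposition3p3 (R : realType) :
  strictly_tighter (@X_of_S R) (@F6_continuous R) (@F2_continuous R).
Proof.
split; first exact: F6_at_least_as_tight_F2.
exists gap_instance, (@uniform_assignment R); split.
  exact: uniform_assignment_F2.
move=> [S [F6S XS]].
pose t2 : period gap_instance := @Ordinal 3 1 isT.
have := XS t2 tt; rewrite X_of_S_gap // /uniform_assignment => e.
by lra.
Qed.
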